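(* For all integers $m,n\ge 1$ and all $\lambda>0$, there exists a learning algorithm that makes $m$ queries of the follower's mixed strategies and that perfectly recovers the follower utility: for every follower utility matrix $V\in[0,1]^{m\times n}$, its output $\tilde V\in\mathbb{R}^{m\times n}$ satisfies $\Phi(V,\tilde V)=0$.
   Context: Stackelberg game setup: the leader has actions $[m]=\{1,\dots,m\}$ and the follower has actions $[n]=\{1,\dots,n\}$. The follower has a utility matrix $V\in[0,1]^{m\times n}$, unknown to the leader; $V_j\in\mathbb{R}^m$ denotes the $j$-th column of $V$. $\Delta_m$ and $\Delta_n$ are the probability simplices in $\mathbb{R}^m$ and $\mathbb{R}^n$. The leader commits to a mixed strategy $\mathbf{x}\in\Delta_m$. Quantal response: with known bounded rationality constant $\lambda>0$, the follower responds to $\mathbf{x}$ with the mixed strategy $\mathbf{y}^V(\mathbf{x})\in\Delta_n$ given by $$y^V_j(\mathbf{x})=\frac{\exp(\lambda\,\mathbf{x}^\top V_j)}{\sum_{k\in[n]}\exp(\lambda\,\mathbf{x}^\top V_k)},\qquad j\in[n].$$ Learning algorithm with mixed-strategy queries: in each round $t$ the algorithm chooses a leader strategy $\mathbf{x}(t)\in\Delta_m$ (possibly depending on past observations) and observes the whole vector $\mathbf{y}^V(\mathbf{x}(t))\in\Delta_n$. After the last round it outputs a matrix $\tilde V\in\mathbb{R}^{m\times n}$ that is a function of $m,n,\lambda$ and the observations. Logit distance: for $V,\tilde V\in\mathbb{R}^{m\times n}$, $$\Phi(V,\tilde V)=\frac{1}{mn}\sum_{i\in[m]}\min_{z\in\mathbb{R}}\sum_{j\in[n]}\left|V_{i,j}-\tilde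 V_{i,j}-z\right|.$$ Recovery is called perfect when $\Phi(V,\tilde V)=0$. *)

(* Defs.v *)
From HB Require Import structures.
From mathcomp Require Import all_boot all_order all_algebra.
From mathcomp Require Import all_classical all_reals all_analysis.

Set Implicit Arguments.
Unset Strict Implicit.
Unset Printing Implicit Defensive.

Import Order.TTheory GRing.Theory Num.Theory.
Import numFieldNormedType.Exports.

Local Open Scope classical_set_scope.
Local Open Scope ring_scope.

Definition simplex (R : realType) (k : nat) : set 'rV[R]_k :=
  [set p | (forall i, 0 <= p 0 i) /\ \sum_i p 0 i = 1].

Definition quantal_response (R : realType) (m n : nat) (lambda : R)
    (V : 'M[R]_(m, n)) (x : 'rV[R]_m) : 'rV[R]_n :=
  \row_j (expR (lambda * (x *m col j V) 0 0) /
          \sum_(k < n) expR (lambda * (x *m col k V) 0 0)).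

(* A deterministic adaptive algorithm.  Histories list the observed responses,
   oldest first; past queries are not recorded since they are determined by
   these responses.  Dependence on m, n and lambda is obtained by quantifying
   over the algorithm after these parameters. *)
Record learning_algorithm (R : realType) (m n : nat) := LearningAlgorithm {
  num_queries : nat;
  query : seq 'rV[R]_n -> 'rV[R]_m;
  query_simplex : forall h, simplex (query h);
  output : seq 'rV[R]_n -> 'M[R]_(m, n)
}.

Fixpoint observations (R : realType) (m n : nat)
    (A : learning_algorithm R m n) (follower : 'rV[R]_m -> 'rV[R]_n)
    (t : nat) : seq 'rV[R]_n :=
  if t is t'.+1 then
    let h := observations A follower t' in rcons h (follower (query A h))
  else [::].

Definition learned_utility (R : realType) (m n : nat) (lambda : R)
    (A : learning_algorithm R m n) (V : 'M[R]_(m, n)) : 'M[R]_(m, n) :=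
  output A (observations A (quantal_response lambda V) (num_queries A)).

Definition shift_cost (R : realType) (m n : nat) (V W : 'M[R]_(m, n))
    (i : 'I_m) (z : R) : R :=
  \sum_(j < n) `|V i j - W i j - z|.

(* The infimum is a minimum: see logit_distance_min below. *)
Definition logit_distance (R : realType) (m n : nat) (V W : 'M[R]_(m, n)) : R :=
  (m * n)%:R^-1 * \sum_(i < m) inf (range (shift_cost V W i)).

Lemma logit_distance_min (R : realType) (m n : nat) (V W : 'M[R]_(m, n))
    (i : 'I_m) :
  exists2 z, inf (range (shift_cost V W i)) = shift_cost V W i z &
    forall z', shift_cost V W i z <= shift_cost V W i z'.
Proof.
set f := shift_cost V W i.
suff [z fz] : exists z, forall z', f z <= f z'.
  exists z => //; apply/eqP; rewrite eq_le; apply/andP; split.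
    by apply: ge_inf; [exists (f z) => _ [z' _ <-]|exists z].
  by apply: lb_le_inf; [exists (f z), z|move=> _ [z' _ <-]].
case: (posnP n) => [n0|n_gt0].
  by exists 0 => z'; rewrite /f /shift_cost !big1// => j _;
    have := ltn_ord j; rewrite {2}n0.
pose j0 := Ordinal n_gt0.
have f_ge z : `|z| - `|V i j0 - W i j0| <= f z.
  rewrite /f /shift_cost (bigD1 j0)//= -[leLHS]addr0 lerD ?sumr_ge0//.
  by rewrite [leRHS]distrC; exact: lerB_dist.
pose M := f 0 + `|V i j0 - W i j0|.
have M_ge0 : 0 <= M by rewrite addr_ge0// sumr_ge0.
have cf : continuous f.
  apply: continuous_big => [|j _ z]; first exact: add_continuous.
  by apply: cvg_norm; apply: cvgB; [exact: cvg_cst|exact: cvg_id].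
have [z _ fz] : exists2 z, z \in `[- M, M] &
    forall z', z' \in `[- M, M] -> f z <= f z'.
  apply: EVT_min; last exact: continuous_subspaceT.
  by rewrite (le_trans _ M_ge0)// oppr_le0.
exists z => z'; have [z'M|Mz'] := leP `|z'| M.
  by apply: fz; rewrite in_itv/= -ler_norml.
apply: (@le_trans _ _ (f 0)); first by apply: fz; rewrite in_itv/= oppr_le0 M_ge0.
by apply: le_trans (f_ge z'); rewrite lerBrDr ltW.
Qed.

(* Main.v *)
(* Querying the vertex e_i of the simplex yields y_j = exp(lambda V_ij) / S_i,
   so ln y_j / lambda is V_ij up to the shift ln S_i / lambda, which does not
   depend on j. *)
Require Import Defs.
From mathcomp Require Import all_boot all_order all_algebra.
From mathcomp Require Import all_classical all_reals all_analysis.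

Import Order.TTheory GRing.Theory Num.Theory.

Local Open Scope ring_scope.

(** The response to the vertex [delta_mx 0 i] is the softmax of row i of [lambda * V], so its
    logarithm gives that row up to one additive constant ([ln_quantal_response]). Dividing by
    [lambda] recovers each row of [V] up to a constant, to which the distance is blind
    ([logit_distance_shift]). *)

Lemma simplex_delta (R : realType) (k : nat) (i : 'I_k) :
  simplex (delta_mx 0 i : 'rV[R]_k).
Proof.
split=> [j|]; first by rewrite mxE ler0n.
rewrite (bigD1 i) //= big1 ?addr0 => [|j ji]; first by rewrite mxE !eqxx.
by rewrite mxE (negPf ji) andbF.
Qed.

Lemma delta_mul_col (R : realType) (m n : nat) (V : 'M[R]_(m, n)) i j :
  ((delta_mx 0 i : 'rV[R]_m) *m col j V) 0 0 = V i j.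
Proof. by rewrite -rowE !mxE. Qed.

Lemma ln_quantal_response (R : realType) (m n : nat) (lambda : R)
    (V : 'M[R]_(m, n)) (i : 'I_m) (j : 'I_n) :
  ln (quantal_response lambda V (delta_mx 0 i) 0 j) =
    lambda * V i j - ln (\sum_(k < n) expR (lambda * V i k)).
Proof.
rewrite mxE delta_mul_col; under eq_bigr do rewrite delta_mul_col.
(* Isolating term j shows that the denominator is positive. *)
rewrite ln_div ?expRK // posrE ?expR_gt0 // (bigD1 j) //=.
by rewrite ltr_wpDr ?expR_gt0 ?sumr_ge0 // => k _; exact: expR_ge0.
Qed.

Lemma observations_nonadaptive (R : realType) (m n : nat)
    (A : learning_algorithm R m n) (q : nat -> 'rV[R]_m) f t :
  (forall h, query A h = q (size h)) -> observations A f t = mkseq (f \o q) t.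
Proof.
move=> Aq; elim: t => //= t IHt.
by rewrite IHt Aq size_mkseq mkseqS.
Qed.

(** The shift [z i] brings the nonnegative cost of row i down to 0. *)
Lemma logit_distance_shift (R : realType) (m n : nat) (V W : 'M[R]_(m, n))
    (z : 'I_m -> R) :
  (forall i j, V i j - W i j = z i) -> logit_distance V W = 0.
Proof.
move=> VWz; rewrite /logit_distance big1 ?mulr0 // => i _.
have [z0 -> z0_min] := logit_distance_min V W i.
apply/eqP; rewrite eq_le sumr_ge0 // andbT (le_trans (z0_min (z i))) //.
by rewrite /shift_cost big1 // => j _; rewrite VWz subrr normr0.
Qed.

Theorem proposition1 (R : realType) (m n : nat) (lambda : R)
    (m_ge1 : (1 <= m)%N) (n_ge1 : (1 <= n)%N) (lambda_gt0 : 0 < lambda) :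
  exists A : learning_algorithm R m n,
    num_queries A = m /\
    forall V : 'M[R]_(m, n),
      (forall i j, 0 <= V i j <= 1) ->
      logit_distance V (learned_utility lambda A V) = 0.
Proof.
case: m m_ge1 => // m _.
(* The number of past answers selects the vertex; only values below [m.+1] matter, where [inord] is
   faithful. *)
pose q k : 'rV[R]_m.+1 := delta_mx 0 (inord k).
exists (LearningAlgorithm m.+1 (fun h => simplex_delta R m.+1 (inord (size h)))
  (fun h => \matrix_(i, j) (ln (nth 0 h i 0 j) / lambda))).
split=> // V _.
(* The shift is the log-partition function of row i, over [lambda]. *)
apply: (@logit_distance_shift _ _ _ _ _
  (fun i => ln (\sum_(k < n) expR (lambda * V i k)) / lambda)) => i j.
rewrite mxE (observations_nonadaptive _ _ _ _ q) // nth_mkseq // /q /= inord_val.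
rewrite ln_quantal_response mulrBl mulrAC divff ?gt_eqF // mul1r.
by rewrite opprB addrC subrK.
Qed.
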